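(* Let $w_{\mathrm{col}}\ge 1$ and $w_{\mathrm{row}}\ge 2$ be integers, and consider a family (sequence) of binary linear codes, with block length $n\to\infty$, each defined by a $(w_{\mathrm{col}},w_{\mathrm{row}})$-regular parity-check matrix. Suppose the codes are used over a binary symmetric channel with cross-over probability $\varepsilon\in(0,1/2)$ and the all-zeros codeword is sent. If the probability that the LP decoder decides in favor of the all-zeros codeword tends to $1$ as $n\to\infty$, then $$\varepsilon\le\frac{1}{w_{\mathrm{row}}}.$$
   Context: A matrix $\mathbf H\in\{0,1\}^{m\times n}$ is $(w_{\mathrm{col}},w_{\mathrm{row}})$-regular if every column contains exactly $w_{\mathrm{col}}$ ones and every row exactly $w_{\mathrm{row}}$ ones. With $\mathbf h_j$ the $j$-th row of $\mathbf H$, let $\mathcal C_j=\{\mathbf x\in\mathbb F_2^n:\mathbf h_j\mathbf x^{\mathsf T}=0 \bmod 2\}$, and let the fundamental polytope be $\mathcal P=\bigcap_{j=1}^m\operatorname{conv}(\mathcal C_j)\subseteq\mathbb R^n$, where $\mathbb F_2=\{0,1\}$ is embedded in $\mathbb R$. When the all-zeros codeword is sent over the binary symmetric channel, the log-likelihood ratios $\Gamma_1,\dots,\Gamma_n$ are i.i.d., equal to $G$ with probability $1-\varepsilon$ and to $-G$ with probability $\varepsilon$, where $G=\log\frac{1-\varepsilon}{\varepsilon}$. Given the realizations $\gamma_i$, the LP decoder outputs $\hat{\boldsymbol\omega}=\arg\min_{\boldsymbol\omega\in\mathcal P}\sum_i\gamma_i\omega_i$; it decides in favor of the all-zeros codeword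 if $\mathbf 0$ is the unique solution of this linear program. *)

(* Defs.v *)
From mathcomp Require Import all_boot all_order all_algebra.
From mathcomp Require Import all_classical all_reals all_analysis.

Set Implicit Arguments.
Unset Strict Implicit.
Unset Printing Implicit Defensive.

Import Order.TTheory GRing.Theory Num.Theory.
Import numFieldNormedType.Exports.

Local Open Scope classical_set_scope.
Local Open Scope ring_scope.

Definition regular_pcm (wcol wrow m n : nat) (H : 'M['F_2]_(m, n)) : Prop :=
  (forall i : 'I_n, #|[set j : 'I_m | H j i == 1]%SET| = wcol) /\
  (forall j : 'I_m, #|[set i : 'I_n | H j i == 1]%SET| = wrow).

Definition check_code (m n : nat) (H : 'M['F_2]_(m, n)) (j : 'I_m) :
    set 'rV['F_2]_n :=
  [set x | row j H *m x^T = 0].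

(* [nat_of_ord] sends the two elements of ['F_2] to the naturals 0 and 1. *)
Definition embed_F2 (R : realType) (n : nat) (x : 'rV['F_2]_n) : 'rV[R]_n :=
  map_mx (fun b : 'F_2 => (nat_of_ord b)%:R) x.

Definition convex_hull (R : realType) (n : nat) (A : set 'rV[R]_n) :
    set 'rV[R]_n :=
  smallest (@convex_set R 'rV[R]_n) A.

Definition fundamental_polytope (R : realType) (m n : nat)
    (H : 'M['F_2]_(m, n)) : set 'rV[R]_n :=
  \bigcap_(j : 'I_m) convex_hull (@embed_F2 R n @` check_code H j).

Definition lp_cost (R : realType) (n : nat) (gamma : 'I_n -> R)
    (omega : 'rV[R]_n) : R :=
  \sum_(i < n) gamma i * omega ord0 i.

Definition lp_solutions (R : realType) (m n : nat) (H : 'M['F_2]_(m, n))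
    (gamma : 'I_n -> R) : set 'rV[R]_n :=
  [set omega | fundamental_polytope H omega /\
    forall omega', fundamental_polytope H omega' ->
      lp_cost gamma omega <= lp_cost gamma omega'].

Definition lp_decides_zero (R : realType) (m n : nat) (H : 'M['F_2]_(m, n))
    (gamma : 'I_n -> R) : Prop :=
  lp_solutions H gamma = [set 0].

(* Taking [B i = setT] outside a subfamily gives the product rule for that
   subfamily. *)
Definition mutually_independent (R : realType) (d : measure_display)
    (T : measurableType d) (P : probability T R) (n : nat)
    (X : 'I_n -> {RV P >-> R}) : Prop :=
  forall B : 'I_n -> set R, (forall i, measurable (B i)) ->
    P (\bigcap_(i : 'I_n) (X i @^-1` B i)) =
    (\prod_(i < n) P (X i @^-1` B i))%E.

(* The log-likelihood ratios of a binary symmetric channel with cross-over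
   probability [eps] when the all-zeros word is sent. *)
Definition bsc_llr (R : realType) (d : measure_display) (T : measurableType d)
    (P : probability T R) (n : nat) (eps : R) (Gamma : 'I_n -> {RV P >-> R}) :
    Prop :=
  let G := ln ((1 - eps) / eps) in
  mutually_independent Gamma /\
  forall i, P (Gamma i @^-1` [set G]) = (1 - eps)%:E /\
            P (Gamma i @^-1` [set - G]) = eps%:E.

(* Main.v *)
(** For a set [E] of flipped positions, give weight [w - 1] to the positions in
    [E] and weight [1] to the others, [w] being the row weight.  In every row the
    resulting vector is a nonnegative combination of vectors [e_i + e_l], with
    [i <> l] in the support of the row, and of vectors [e_i], with [i] off the
    support; these are local codewords, so a small positive multiple of the vector
    lies in the fundamental polytope.  Its cost is a positive multiple of
    [n - w * #|E|], hence success forces [w * #|E| < n].  If [eps > 1 / w], a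
    Chernoff bound makes the probability of this event exponentially small in
    [n]. *)
Require Import Defs.
From mathcomp Require Import all_boot all_order all_algebra.
From mathcomp Require Import all_classical all_reals all_analysis.
From mathcomp Require Import ring lra.
Import Order.TTheory GRing.Theory Num.Theory.
Import numFieldNormedType.Exports.
Local Open Scope classical_set_scope.
Local Open Scope ring_scope.

Set Implicit Arguments.
Unset Strict Implicit.

(** * Convex hulls and the cones over them *)

Section ConvexSets.
Variables (R : realType) (n : nat).
Implicit Types A : set 'rV[R]_n.

Lemma convex_setP A :
  @convex_set R 'rV[R]_n A <->
  forall a b (t : R), 0 <= t <= 1 -> A a -> A b -> A (t *: a + (1 - t) *: b).
Proof.
split=> [cA a b t /andP[t0 t1] Aa Ab|cA a b t].
  by have := cA a b (Itv01 t0 t1); rewrite !in_setE => /(_ Aa Ab).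
rewrite !in_setE => Aa Ab; apply: cA => //.
by rewrite ge0 le1.
Qed.

Lemma convex_convex_hull A : @convex_set R 'rV[R]_n (convex_hull A).
Proof.
apply/convex_setP => a b t t01 Ha Hb B [cB AB].
by apply: (convex_setP B).1 => //; [exact: Ha | exact: Hb].
Qed.

(** The weights are not normalised: terms are merged one at a time by convexity, and the
    nonemptiness of [A] supplies [b] when the total weight is zero. *)
Lemma convex_set_sum A (I : Type) (r : seq I) (p : pred I) (t : I -> R)
    (a : I -> 'rV[R]_n) :
  @convex_set R 'rV[R]_n A -> A !=set0 ->
  (forall i, p i -> 0 <= t i /\ A (a i)) ->
  exists2 b, A b &
    \sum_(i <- r | p i) t i *: a i = (\sum_(i <- r | p i) t i) *: b.
Proof.
move=> /convex_setP cA [a0 Aa0] Ha.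
suff [] : 0 <= \sum_(i <- r | p i) t i /\ exists2 b, A b &
    \sum_(i <- r | p i) t i *: a i = (\sum_(i <- r | p i) t i) *: b by [].
apply: (big_rec2 (fun x y => 0 <= y /\ exists2 b, A b & x = y *: b)).
  by split=> //; exists a0; rewrite ?scale0r.
move=> i _ s /Ha[ti0 Ai] [s0 [b Ab ->]]; split; first exact: addr_ge0.
have [ts0|ts0] := eqVneq (t i + s) 0.
  exists a0 => //; rewrite ts0 scale0r.
  move/eqP: ts0; rewrite paddr_eq0// => /andP[/eqP-> /eqP->].
  by rewrite !scale0r addr0.
have tsgt0 : 0 < t i + s by rewrite lt_def ts0 addr_ge0.
exists ((t i / (t i + s)) *: a i + (1 - t i / (t i + s)) *: b).
  apply: cA => //; rewrite divr_ge0 ?(ltW tsgt0)//=.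
  by rewrite ler_pdivrMr// mul1r lerDl.
rewrite scalerDr !scalerA mulrBr mulr1 mulrCA divff// mulr1.
by rewrite [t i + s - t i]addrAC subrr add0r.
Qed.

(** Membership is insensitive to positive scaling, so sums of codewords need no normalisation;
    [in_cone_bigcap] leads back from cones to the sets themselves. *)
Definition in_cone A (v : 'rV[R]_n) : Prop :=
  exists2 t : R, 0 <= t & exists2 a, A a & v = t *: a.

Lemma in_cone_sum A (I : Type) (r : seq I) (p : pred I) (v : I -> 'rV[R]_n) :
  @convex_set R 'rV[R]_n A -> A !=set0 ->
  (forall i, p i -> in_cone A (v i)) -> in_cone A (\sum_(i <- r | p i) v i).
Proof.
move=> cA A0 Hv.
have /choice[ta Hta] : forall i, exists ta : R * 'rV[R]_n,
    p i -> [/\ 0 <= ta.1, A ta.2 & v i = ta.1 *: ta.2].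
  move=> i; have [/Hv[t t0 [a Aa ->]]|] := boolP (p i); last by exists (0, 0).
  by exists (t, a).
have [|b Ab e] := @convex_set_sum A I r p (fun i => (ta i).1)
    (fun i => (ta i).2) cA A0.
  by move=> i /Hta[].
exists (\sum_(i <- r | p i) (ta i).1).
  by apply: sumr_ge0 => i /Hta[].
by exists b => //; rewrite -e; apply: eq_bigr => i /Hta[].
Qed.

Lemma in_coneD A u v : @convex_set R 'rV[R]_n A -> A !=set0 ->
  in_cone A u -> in_cone A v -> in_cone A (u + v).
Proof.
move=> cA A0 Hu Hv.
rewrite (_ : u + v = \sum_(b : bool) if b then u else v).
  by apply: in_cone_sum => // -[].
by rewrite big_bool.
Qed.

Lemma in_coneZ A (t : R) v : 0 <= t -> in_cone A v -> in_cone A (t *: v).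
Proof.
move=> t0 [u u0 [a Aa ->]]; exists (t * u); first exact: mulr_ge0.
by exists a => //; rewrite scalerA.
Qed.

(** A convex set containing 0 is stable under shrinking towards 0, so one factor that is small
    enough for each of the finitely many sets serves them all. *)
Lemma in_cone_bigcap (m : nat) (B : 'I_m -> set 'rV[R]_n) v :
  (forall j, @convex_set R 'rV[R]_n (B j)) -> (forall j, B j 0) ->
  (forall j, in_cone (B j) v) ->
  exists2 c : R, 0 < c & (\bigcap_(j : 'I_m) B j) (c *: v).
Proof.
move=> cB B0 Hv.
have /choice[t Ht] : forall j, exists t : R,
    0 <= t /\ exists2 a, B j a & v = t *: a.
  by move=> j; have [t t0 Ha] := Hv j; exists t.
(* This [s] dominates every [t j], and the summand 1 keeps it positive when all of them vanish. *)
pose s := 1 + \sum_j t j.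
have s0 : 0 < s by apply: ltr_pwDl => //; apply: sumr_ge0 => j _; case: (Ht j).
exists s^-1; first by rewrite invr_gt0.
move=> j _; have [tj0 [a Ba ->]] := Ht j.
rewrite scalerA -[X in B j X]addr0 -[X in _ + X](scaler0 _ (1 - s^-1 * t j)).
apply: (convex_setP (B j)).1 => //.
rewrite mulr_ge0 ?invr_ge0 ?(ltW s0)//= mulrC ler_pdivrMr// mul1r /s.
rewrite (bigD1 j)//= addrCA lerDl addr_ge0//.
by apply: sumr_ge0 => i _; case: (Ht i).
Qed.

Lemma convex_hull_seq (s : seq 'rV[R]_n) :
  convex_hull [set` s] =
  (fun t : 'rV[R]_(size s) => \sum_i t ord0 i *: s`_i) @`
    [set t : 'rV[R]_(size s) | (forall i, 0 <= t ord0 i) /\ \sum_i t ord0 i = 1].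
Proof.
apply/seteqP; split.
  apply: smallest_sub => /=.
    apply/convex_setP => _ _ t /andP[t0 t1] [u [u0 u1] <-] [v [v0 v1] <-].
    exists (t *: u + (1 - t) *: v); first split.
    - by move=> i; rewrite !mxE addr_ge0 ?mulr_ge0 ?subr_ge0.
    - under eq_bigr do rewrite !mxE.
      by rewrite big_split/= -!mulr_sumr u1 v1 !mulr1 addrC subrK.
    - rewrite !scaler_sumr -big_split/=; apply: eq_bigr => i _.
      by rewrite !mxE !scalerA -scalerDl.
  move=> a /= sa; have isa : (index a s < size s)%N by rewrite index_mem.
  exists (delta_mx ord0 (Ordinal isa)); first split.
  - by move=> i; rewrite mxE ler0n.
  - rewrite (bigD1 (Ordinal isa))//= mxE !eqxx big1 ?addr0// => i /negbTE iN.
    by rewrite mxE iN andbF.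
  - rewrite (bigD1 (Ordinal isa))//= mxE !eqxx scale1r nth_index//.
    rewrite big1 ?addr0// => i /negbTE iN.
    by rewrite mxE iN andbF scale0r.
move=> _ [t [t0 t1] <-].
have sH i : (i < size s)%N -> convex_hull [set` s] s`_i.
  by move=> si; apply: sub_gen_smallest => /=; rewrite mem_nth.
have H0 : convex_hull [set` s] !=set0.
  (* Weights with sum 1 cannot exist over the empty list. *)
  move: t t1 {t0} sH; case: (size s) => [|k] t t1 sH.
    by move: t1; rewrite big_ord0 => /esym/eqP; rewrite oner_eq0.
  by exists s`_0; apply: sH.
have [//|b Hb ->] := @convex_set_sum _ 'I_(size s) (index_enum _) xpredT
  (fun i => t ord0 i) (fun i => s`_i) (@convex_convex_hull [set` s]) H0.
  by move=> i _; split=> //; apply: sH.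
by rewrite t1 scale1r.
Qed.

(** By [convex_hull_seq] the hull is the continuous image of a standard simplex, which is compact as
    a closed subset of a cube. *)
Lemma closed_convex_hull A : finite_set A -> closed (convex_hull A).
Proof.
move=> /finite_seqP[s ->]; rewrite convex_hull_seq.
apply: compact_closed; first exact: norm_hausdorff.
apply: continuous_compact.
  apply: continuous_subspaceT => t.
  apply: continuous_big => [|i _]; first exact: add_continuous.
  by move=> u; apply: (@cvgZr_tmp _ _ _ (nbhs u)); exact: coord_continuous.
have cube : compact [set t : 'rV[R]_(size s) | forall i, t ord0 i \in `[0, 1]].
  by apply: (@rV_compact R _ (fun=> `[0, 1]%classic)) => _; exact: segment_compact.
apply: subclosed_compact cube _ => [|t [t0 t1] i]; last first.
  rewrite in_itv/= t0 -t1 (bigD1 i)//= lerDl.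
  by apply: sumr_ge0 => k _.
rewrite (_ : mkset _ =
    (\bigcap_i (fun t : 'rV[R]_(size s) => t ord0 i) @^-1` [set x | 0 <= x]) `&`
    (fun t : 'rV[R]_(size s) => \sum_i t ord0 i) @^-1` [set 1]); last first.
  by apply/seteqP; split=> t [t0 t1]; split=> // i; have := t0 i; [|exact].
apply: closedI.
  apply: closed_bigI => i _; apply: closed_comp; last exact: closed_ge.
  by move=> x _; exact: coord_continuous.
apply: closed_comp; last exact: closed_eq.
move=> x _; move: x; apply: continuous_big => [|i _].
  exact: add_continuous.
exact: coord_continuous.
Qed.

End ConvexSets.

(** * Measurability of positivity conditions on random linear costs *)

Section Measurability.
Variables (R : realType) (n : nat).

(** An open set is the union of the boxes with rational corners that it contains, and there are only
    countably many such boxes. *)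
Lemma measurable_open_rV d (T : measurableType d) (X : 'I_n -> T -> R)
    (U : set 'rV[R]_n) :
  (forall i, measurable_fun setT (X i)) -> open U ->
  measurable [set t | U (\row_i X i t)].
Proof.
move=> mX oU.
pose box (q : {ffun 'I_n -> rat * rat}) : set 'rV[R]_n :=
  [set v : 'rV[R]_n | forall i, v ord0 i \in `](ratr (q i).1), (ratr (q i).2)[].
rewrite (_ : mkset _ = \bigcup_q
    [set t | box q `<=` U /\ box q (\row_i X i t)]); last first.
  apply/seteqP; split=> [t /= Ut|t [q _ [/= qU qt]]]; last exact: qU.
  have /nbhs_ballP[e /= e0 eU] := open_nbhs_nbhs (conj oU Ut).
  have /choice[q1 q1P] (i : 'I_n) : exists p : rat, ratr p \in `](X i t - e), (X i t)[.
    by apply: rat_in_itvoo; rewrite ltrBlDr ltrDl.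
  have /choice[q2 q2P] (i : 'I_n) : exists p : rat, ratr p \in `](X i t), (X i t + e)[.
    by apply: rat_in_itvoo; rewrite ltrDl.
  exists [ffun i => (q1 i, q2 i)] => //; split=> [v qv|i]; last first.
    move: (q1P i) (q2P i); rewrite !in_itv/= !mxE ffunE/=.
    by move=> /andP[_ ->] /andP[->].
  apply: eU; split=> // i j; rewrite ord1 !mxE /ball/=.
  move: (q1P j) (q2P j) (qv j); rewrite !in_itv/= ffunE/=.
  rewrite ltr_distlC; lra.
apply: countable_bigcupT_measurable => // q.
(* The inclusion does not involve [t], so the event is either empty or that of the whole box. *)
have [qU|qU] := pselect (box q `<=` U); last first.
  by rewrite (_ : mkset _ = set0)//; apply/seteqP; split=> t //= -[].
rewrite (_ : mkset _ = \bigcap_(i in [set: 'I_n])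
    (X i @^-1` [set` `](ratr (q i).1), (ratr (q i).2)[])); last first.
  apply/seteqP; split=> [t [_ qt] i _|t qt]; first by have := qt i; rewrite mxE.
  by split=> // i; rewrite mxE; exact: qt.
apply: fin_bigcap_measurable => // i _.
by rewrite -[X in measurable X]setTI; exact: mX.
Qed.

Lemma lp_cost_continuous :
  continuous (fun p : 'rV[R]_n * 'rV[R]_n => lp_cost (p.1 ord0) p.2).
Proof.
apply: continuous_big => [|i _]; first exact: add_continuous.
move=> p; apply: cvgM.
  by apply: (@cvg_comp _ _ _ fst (fun v : 'rV[R]_n => v ord0 i) _ (nbhs p.1));
    [exact: cvg_fst|exact: coord_continuous].
by apply: (@cvg_comp _ _ _ snd (fun v : 'rV[R]_n => v ord0 i) _ (nbhs p.2));
  [exact: cvg_snd|exact: coord_continuous].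
Qed.

(** A tube argument: positivity at [(v, w)] persists on a product neighbourhood, and compactness of
    [K] yields one neighbourhood of [v] that serves all [w]. *)
Lemma open_lp_cost_gt0 (K : set 'rV[R]_n) : compact K ->
  open [set v : 'rV[R]_n | forall w, K w -> 0 < lp_cost (v ord0) w].
Proof.
move=> /compact_near_coveringP cK; rewrite openE => v /= Kv; rewrite /interior.
have := cK _ (nbhs v) (fun (v : 'rV[R]_n) w => 0 < lp_cost (v ord0) w) _.
apply => w Kw.
have : nbhs (v, w) [set p : 'rV[R]_n * 'rV[R]_n | 0 < lp_cost (p.1 ord0) p.2].
  apply: (@lp_cost_continuous (v, w) [set x | 0 < x]).
  by apply: open_nbhs_nbhs; split; [exact: open_gt|exact: Kv].
by move=> [[A B] [/= nA nB] AB]; exists (B, A) => // -[b a] [/= Bb Aa]; exact: (AB (a, b)).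
Qed.

(** As stated, the event is a possibly uncountable intersection over [w]. Compact pieces turn it
    into a countable intersection of preimages of open sets; they avoid 0, where the cost
    vanishes. *)
Lemma measurable_lp_cost_gt0 d (T : measurableType d) (X : 'I_n -> T -> R)
    (C : set 'rV[R]_n) :
  (forall i, measurable_fun setT (X i)) -> closed C ->
  measurable [set t | forall w, C w -> w != 0 -> 0 < lp_cost (X ^~ t) w].
Proof.
move=> mX cC.
(* [C] without [0] is exhausted by the compact sets [K k]. *)
pose K k : set 'rV[R]_n :=
  C `&` [set w : 'rV[R]_n | k.+1%:R^-1 <= `|w| ] `&` [set w : 'rV[R]_n | `|w| <= k.+1%:R].
have cK k : compact (K k).
  apply: bounded_closed_compact.
    exists k.+1%:R; split; first exact: num_real.
    by move=> M kM w /= [_ /= /le_trans]; apply; exact: ltW.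
  apply: closedI; first apply: closedI => //.
    apply: (@closed_comp _ _ (fun w : 'rV[R]_n => `|w|) [set x | k.+1%:R^-1 <= x]);
      last exact: closed_ge.
    by move=> w _; exact: norm_continuous.
  apply: (@closed_comp _ _ (fun w : 'rV[R]_n => `|w|) [set x | x <= k.+1%:R]);
    last exact: closed_le.
  by move=> w _; exact: norm_continuous.
rewrite (_ : mkset _ = \bigcap_k [set t | [set v : 'rV[R]_n |
    forall w, K k w -> 0 < lp_cost (v ord0) w] (\row_i X i t)]).
  apply: bigcapT_measurable => k; apply: measurable_open_rV => //.
  exact: open_lp_cost_gt0.
have rE t : lp_cost ((\row_i X i t) ord0) = lp_cost (X ^~ t).
  by apply/funext => w; apply: eq_bigr => i _; rewrite mxE.
apply/seteqP; split=> [t Ht k _ w [[Cw /= kw] _]|t Ht w Cw w0].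
  rewrite rE; apply: Ht => //; rewrite -normr_gt0.
  by apply: lt_le_trans kw; rewrite invr_gt0.
rewrite -rE.
(* Both [|w|] and its inverse are then less than [k.+1]. *)
pose k := maxn (Num.truncn `|w|) (Num.truncn `|w|^-1).
apply: (Ht k) => //; split; first split=> //=.
  rewrite -[leRHS]invrK lef_pV2 ?posrE ?invr_gt0 ?normr_gt0 //.
  apply: le_trans (ltW (truncnS_gt _)) _.
  by rewrite ler_nat ltnS leq_maxr.
apply: le_trans (ltW (truncnS_gt _)) _.
by rewrite ler_nat ltnS leq_maxl.
Qed.

End Measurability.

(** * Pseudocodewords in the fundamental polytope *)

Section FundamentalPolytope.
Variables (R : realType) (m n : nat) (H : 'M['F_2]_(m, n)).

Local Notation hull j := (convex_hull (@embed_F2 R n @` check_code H j)).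

Lemma embed_check_code_hull (j : 'I_m) (x : 'rV['F_2]_n) :
  row j H *m x^T = 0 -> hull j (embed_F2 R x).
Proof. by move=> Hx; apply: sub_gen_smallest; exists x. Qed.

Lemma hull_check_code0 (j : 'I_m) : hull j 0.
Proof.
have := @embed_check_code_hull j 0; rewrite trmx0 mulmx0 => /(_ erefl).
by congr (convex_hull _ _); apply/rowP => i; rewrite !mxE.
Qed.

Lemma closed_fundamental_polytope : closed (@fundamental_polytope R _ _ H).
Proof.
apply: closed_bigI => j _; apply: closed_convex_hull.
by apply: finite_image; exact: finite_finset.
Qed.

(** The origin lies in the polytope and has cost 0, so it fails to be the unique minimiser exactly
    when some nonzero point costs at most 0. *)
Lemma lp_decides_zeroP (gamma : 'I_n -> R) :
  lp_decides_zero H gamma <->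
  forall w, fundamental_polytope H w -> w != 0 -> 0 < lp_cost gamma w.
Proof.
have cost0 : lp_cost gamma 0 = 0.
  by rewrite /lp_cost big1// => i _; rewrite mxE mulr0.
have P0 : @fundamental_polytope R _ _ H 0 by move=> j _; exact: hull_check_code0.
split=> [dz w Pw w0|pos].
  have : lp_solutions H gamma 0 by rewrite dz.
  rewrite ltNge; move=> [_ le0]; apply/negP => lew; move/eqP: w0; apply.
  suff : lp_solutions H gamma w by rewrite dz.
  by split=> // v /le0; apply: le_trans; rewrite cost0.
apply/seteqP; split=> [w [Pw wmin]|_ ->] /=.
  apply/eqP/contraT => /(pos _ Pw); rewrite ltNge -{1}cost0.
  by rewrite wmin.
split=> // w Pw; rewrite cost0.
by have [->|/(pos _ Pw)/ltW//] := eqVneq w 0; rewrite cost0.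
Qed.

Local Notation e i := (delta_mx ord0 i : 'rV[R]_n).

Lemma in_cone_unit (j : 'I_m) (i : 'I_n) : H j i != 1 -> in_cone (hull j) (e i).
Proof.
move=> Hji; exists 1; first exact: ler01.
exists (e i); last by rewrite scale1r.
rewrite (_ : e i = embed_F2 R (delta_mx ord0 i)).
  apply: embed_check_code_hull; apply/matrixP => a b.
  rewrite trmx_delta -colE !mxE.
  by case: (H j i) Hji => -[|[|//]] // k _; exact/val_inj.
by apply/rowP => l; rewrite !mxE; case: (_ && _).
Qed.

Lemma in_cone_pair (j : 'I_m) (i l : 'I_n) : H j i = 1 -> H j l = 1 -> i != l ->
  in_cone (hull j) (e i + e l).
Proof.
move=> Hji Hjl il; exists 1; first exact: ler01.
exists (e i + e l); last by rewrite scale1r.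
rewrite (_ : e i + e l = embed_F2 R (delta_mx ord0 i + delta_mx ord0 l)).
  apply: embed_check_code_hull; apply/matrixP => a b.
  rewrite linearD/= mulmxDr !trmx_delta -!colE !mxE Hji Hjl.
  by apply/val_inj.
(* The embedding is not additive in general, since 1 + 1 = 0 in ['F_2]; here it is, because [i] and
   [l] differ. *)
apply/rowP => k; rewrite !mxE/=.
have [->|_] := eqVneq k i; first by rewrite (negbTE il) !addr0.
by case: (_ == _); rewrite !add0r.
Qed.

(* The sum is taken over stars, [\sum_(l in S | l != i) (e i + e l)] having weight
   [#|S| - 1] at [i] and [1] at the other elements of [S]. *)
Lemma sum_pairs (M S : {set 'I_n}) : M \subset S ->
  \sum_(i in M) \sum_(l in S | l != i) (e i + e l) =
  #|M|%:R *: (\sum_(i in S) e i) + (#|S|%:R - 2) *: (\sum_(i in M) e i).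
Proof.
move=> /fintype.subsetP MS.
rewrite scaler_nat -sumr_const scaler_sumr -big_split/=.
apply: eq_bigr => i /MS iS; rewrite big_split/= sumr_const.
rewrite [\sum_(l in S) e l](bigD1 i)//= (cardsD1 i S) iS.
rewrite (_ : (true + _)%:R - 2 = #|S :\ i|%:R - 1 :> R); last first.
  by rewrite add1n -natr1; ring.
rewrite scalerBl scale1r scaler_nat addrAC [e i + (_ - _)]addrC subrK.
by congr (_ *+ _ + _); apply: eq_card => l; rewrite !inE andbC.
Qed.

Lemma in_cone_sum_pairs (j : 'I_m) (M S : {set 'I_n}) :
  {in S, forall i, H j i = 1} -> M \subset S ->
  in_cone (hull j)
    (#|M|%:R *: (\sum_(i in S) e i) + (#|S|%:R - 2) *: (\sum_(i in M) e i)).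
Proof.
move=> HS MS; rewrite -sum_pairs//.
have cH := @convex_convex_hull R n (@embed_F2 R n @` check_code H j).
have H0 : hull j !=set0 by exists 0; exact: hull_check_code0.
apply: in_cone_sum => // i iM; apply: in_cone_sum => // l /andP[lS li].
by apply: in_cone_pair; rewrite ?HS 1?eq_sym//; exact: (fintype.subsetP MS).
Qed.

(** Off the support [S] of the row, unit vectors suffice. On [S] the target is the indicator of [S]
    plus w - 2 times that of [M], the flipped positions in [S]; it is assembled from stars. *)
Lemma in_cone_pseudocodeword (j : 'I_m) (w : nat) (E : {set 'I_n}) :
  (2 <= w)%N -> #|[set i | H j i == 1]%SET| = w ->
  in_cone (hull j) (\sum_i (if i \in E then w.-1%:R else 1) *: e i).
Proof.
move=> w2; set S := finset _ => Sw.
have HS : {in S, forall i, H j i = 1} by move=> i; rewrite inE => /eqP.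
have cH := @convex_convex_hull R n (@embed_F2 R n @` check_code H j).
have H0 : hull j !=set0 by exists 0; exact: hull_check_code0.
rewrite (bigID [in S])/=; apply: in_coneD => //; last first.
  apply: in_cone_sum => // i iS; apply: in_coneZ; first by case: ifP.
  by apply: in_cone_unit; move: iS; rewrite inE.
pose M := S :&: E.
rewrite (_ : \sum_(i in S) _ =
    \sum_(i in S) e i + (w%:R - 2) *: \sum_(i in M) e i); last first.
  rewrite scaler_sumr (big_setID M)/= [in RHS](big_setID M)/=.
  rewrite (finset.setIidPr _) ?finset.subsetIl// addrAC -big_split/=; congr (_ + _).
    apply: eq_bigr => i; rewrite inE => /andP[_ ->].
    rewrite -[X in X + _]scale1r -scalerDl; congr (_ *: _).
    by rewrite -{2}(ltn_predK w2) -natr1; ring.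
  apply: eq_bigr => i; rewrite !inE => /andP[+ iS]; rewrite iS/= => /negbTE->.
  by rewrite scale1r.
have w2R : 2 <= w%:R :> R by rewrite ler_nat.
(* With no flipped position in the row, the stars centred at all points of [S] add up to 2w - 2
   times the indicator of [S]. *)
have [M0|M0] := eqVneq #|M| 0%N.
  rewrite (cards0_eq M0) big_set0 scaler0 addr0.
  have w2n0 : w%:R + (w%:R - 2) != 0 :> R by apply/lt0r_neq0; lra.
  rewrite -[X in in_cone _ X]scale1r -(mulVf w2n0) -scalerA.
  apply: in_coneZ; first by rewrite invr_ge0; lra.
  have := in_cone_sum_pairs HS (fintype.subxx S).
  by rewrite Sw -scalerDl.
have q0 : 0 < #|M|%:R :> R by rewrite ltr0n lt0n.
have MS : M \subset S by exact: finset.subsetIl.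
have HM : {in M, forall i, H j i = 1} by move=> i /(fintype.subsetP MS)/HS.
(* Let q be the size of [M]. Stars from [M] into [S] give q on [S] and a further w - 2 on [M]; stars
   inside [M] give 2(q - 1) on [M]. The factor x = (w - 2)/2 solves (w - 2) + 2x(q - 1) = q(w -
   2). *)
rewrite (_ : _ + _ = #|M|%:R^-1 *: ((#|M|%:R *: (\sum_(i in S) e i)
      + (#|S|%:R - 2) *: (\sum_(i in M) e i))
    + ((w%:R - 2) / 2) *: (#|M|%:R *: (\sum_(i in M) e i)
      + (#|M|%:R - 2) *: (\sum_(i in M) e i)))).
  apply: in_coneZ; first by rewrite invr_ge0 ltW.
  apply: in_coneD => //; first exact: in_cone_sum_pairs.
  apply: in_coneZ; first by lra.
  exact: in_cone_sum_pairs.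
rewrite Sw -addrA scalerDr scalerA mulVf ?gt_eqF// scale1r; congr (_ + _).
rewrite -scalerDl !scalerA -scalerDl scalerA; congr (_ *: _).
by field; rewrite gt_eqF.
Qed.

Lemma fundamental_polytope_pseudocodeword (w : nat) (E : {set 'I_n}) :
  (2 <= w)%N -> (forall j, #|[set i | H j i == 1]%SET| = w) ->
  exists2 c : R, 0 < c & fundamental_polytope H
    (c *: \sum_i (if i \in E then w.-1%:R else 1) *: e i).
Proof.
move=> w2 Hw; apply: in_cone_bigcap => j.
- exact: convex_convex_hull.
- exact: hull_check_code0.
- exact: in_cone_pseudocodeword.
Qed.

Lemma lp_decides_zero_few_errors (w : nat) (G : R) (E : {set 'I_n}) :
  (0 < n)%N -> (2 <= w)%N -> (forall j, #|[set i | H j i == 1]%SET| = w) ->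
  0 < G -> lp_decides_zero H (fun i => if i \in E then - G else G) ->
  (w * #|E| < n)%N.
Proof.
move=> n0 w2 Hw G0 /lp_decides_zeroP dz.
have [c c0 /dz] := fundamental_polytope_pseudocodeword E w2 Hw.
set v := \sum_i _.
have vE i : v ord0 i = if i \in E then w.-1%:R else 1.
  rewrite summxE (bigD1 i)//= !mxE !eqxx mulr1 big1 ?addr0// => l li.
  by rewrite !mxE eq_sym (negbTE li) mulr0.
have vi i : 0 < v ord0 i.
  by rewrite vE; case: ifP => // _; rewrite ltr0n -subn1 subn_gt0.
have cv0 : c *: v != 0.
  apply/eqP => /rowP /(_ (Ordinal n0)); rewrite !mxE => /eqP.
  by rewrite mulf_eq0 !gt_eqF.
move=> /(_ cv0).
rewrite /lp_cost.
have -> : \sum_(i < n) (if i \in E then - G else G) * (c *: v) ord0 i =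
    c * G * (n%:R - w%:R * #|E|%:R).
  (* In units of [c * G], a flipped position contributes -(w - 1) = 1 - w and any other position
     1. *)
  rewrite (eq_bigr (fun i => c * G * (1 - w%:R * (i \in E)%:R))) => [|i _].
    rewrite -mulr_sumr sumrB sumr_const card_ord -mulr_sumr -natr_sum.
    congr (_ * (_ - _ * _%:R)); rewrite -sum1_card [RHS]big_mkcond/=.
    by apply: eq_bigr => i _; case: (i \in E).
  rewrite mxE vE; case: ifP => _; last by rewrite mulr0 subr0; ring.
  by rewrite -{2}(ltn_predK w2) -natr1 /=; ring.
by rewrite pmulr_rgt0 ?mulr_gt0// subr_gt0 -natrM ltr_nat.
Qed.

End FundamentalPolytope.

(** * Chernoff bound for the probability of few errors *)

Section ChernoffBound.
Variable R : realType.
Implicit Types p s : R.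

Lemma bernoulli_ineq s k : 0 <= s -> 1 + k%:R * s <= (1 + s) ^+ k.
Proof.
move=> s0; elim: k => [|k IHk]; first by rewrite expr0 mul0r addr0.
rewrite exprSr; apply: le_trans (ler_wpM2r _ IHk); last by rewrite addr_ge0.
have ks : 0 <= k%:R * (s * s) by rewrite !mulr_ge0.
by rewrite -natr1; lra.
Qed.

(* Chernoff: each summand gets the extra factor [(1 + s) ^ (n - w * #|S|)]. *)
Lemma sum_few_errors_le (n w : nat) p s : 0 <= p <= 1 -> 0 <= s ->
  \sum_(S : {set 'I_n} | (w * #|S| < n)%N)
    \prod_(i < n) (if i \in S then p else 1 - p) <=
  (p * ((1 + s) / (1 + s) ^+ w) + (1 - p) * (1 + s)) ^+ n.
Proof.
move=> /andP[p0 p1] s0.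
have q0 : 0 <= 1 - p by rewrite subr_ge0.
have s1 : 0 < 1 + s by rewrite ltr_wpDr.
have prod_ge0 S :
    0 <= \prod_(i < n) (if i \in S then p else 1 - p) by apply: prodr_ge0 => i _; case: ifP.
(* Distributing the power over its [n] factors gives a sum over all subsets [S]; the terms with too
   large [S] are nonnegative and only enlarge it. *)
rewrite -[X in _ ^+ X](card_ord n) -prodr_const (bigA_distr 1 +%R).
rewrite big_mkcond; apply: ler_sum => S _.
rewrite [leRHS](_ : _ = (\prod_(i < n) if i \in S then p else 1 - p) *
    ((1 + s) ^+ n / (1 + s) ^+ (w * #|S|))).
  case: ifP => [wSn|_]; last by rewrite mulr_ge0// divr_ge0// exprn_ge0// ltW.
  rewrite ler_peMr// ler_pdivlMr ?exprn_gt0// mul1r ler_weXn2l ?lerDl//.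
  exact: ltnW.
rewrite (eq_bigr (fun i : 'I_n => (if i \in S then p else 1 - p) *
    ((1 + s) * (if i \in S then ((1 + s) ^+ w)^-1 else 1)))); last first.
  by move=> i _; case: ifP => _; rewrite ?mulr1.
rewrite !big_split/= prodr_const card_ord -big_mkcond/= prodr_const.
by rewrite exprM exprVn.
Qed.

(** The base is the mean of (1 + s)^(1 - wX) for a Bernoulli variable X of parameter [p]. The
    exponent has negative mean 1 - wp, so a suitable small [s] brings the base below 1. *)
Lemma chernoff_base_lt1 (w : nat) p : p <= 1 -> 1 < w%:R * p ->
  exists2 s, 0 <= s &
    0 <= p * ((1 + s) / (1 + s) ^+ w) + (1 - p) * (1 + s) < 1.
Proof.
move=> p1 wp.
have w0 : 0 < w%:R :> R.
  by rewrite ltr0n lt0n; apply: contraTneq wp => ->; rewrite mul0r ltr10.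
have p0 : 0 < p by rewrite -(pmulr_rgt0 _ w0); lra.
(* Here ws = wp - 1, so Bernoulli's inequality gives (1 + s)^w >= wp, and the base is at most (1 +
   s)(1/w + 1 - p) = (1 + s)(1 - s) = 1 - s^2. *)
pose s := p - w%:R^-1.
have ws : w%:R * s = w%:R * p - 1 by rewrite mulrBr divff ?gt_eqF.
have s0 : 0 < s by rewrite -(pmulr_rgt0 _ w0) ws subr_gt0.
have s1 : 0 < 1 + s by rewrite ltr_wpDr// ltW.
exists s; first exact: ltW.
apply/andP; split.
  rewrite addr_ge0// mulr_ge0 ?subr_ge0 ?(ltW p0) ?(ltW s1)//.
  by rewrite divr_ge0 ?exprn_ge0// ltW.
have ws1 : 0 < w%:R * p by lra.
apply: (@le_lt_trans _ _ (p * ((1 + s) / (w%:R * p)) + (1 - p) * (1 + s))).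
  rewrite lerD2r; apply: ler_wpM2l; first exact: ltW.
  rewrite ler_pM2l// lef_pV2 ?posrE ?exprn_gt0//.
  by have := @bernoulli_ineq s w (ltW s0); rewrite ws; lra.
rewrite (_ : p * _ = (1 + s) / w%:R); last by field; rewrite !gt_eqF.
rewrite -mulrC -mulrDl (_ : w%:R^-1 + (1 - p) = 1 - s); last by rewrite /s; ring.
have : 0 < s * s by rewrite mulr_gt0.
lra.
Qed.

End ChernoffBound.

(** * Success probability of the LP decoder *)

Section SuccessProbability.
Variables (R : realType) (d : measure_display) (T : measurableType d).

Lemma measure_bigsetU_le (mu : {measure set T -> \bar R}) (I : Type)
    (r : seq I) (p : pred I) (A : I -> set T) :
  (forall i, measurable (A i)) ->
  (mu (\big[setU/set0]_(i <- r | p i) A i) <= \sum_(i <- r | p i) mu (A i))%E.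
Proof.
move=> mA; elim: r => [|i r IHr]; first by rewrite !big_nil measure0.
rewrite !big_cons; case: ifP => // _.
apply: le_trans (leeD2l _ IHr).
by apply: measureU2 => //; apply: bigsetU_measurable.
Qed.

Variables (P : probability T R) (m n : nat) (H : 'M['F_2]_(m, n)).
Variables (eps : R) (Gamma : 'I_n -> {RV P >-> R}).
Hypotheses (eps_gt0 : 0 < eps) (eps_lt : eps < 1 / 2).
Hypothesis llr : bsc_llr eps Gamma.

Let G := ln ((1 - eps) / eps).

Let G_gt0 : 0 < G.
Proof. by apply: ln_gt0; rewrite ltr_pdivlMr// mul1r; move: eps_lt; lra. Qed.

(* A measure is unspecified on nonmeasurable sets, and the LLRs are only almost
   surely equal to [G] or [- G], so that measurability is a statement about the
   LP with arbitrary real costs. *)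
Lemma measurable_lp_decides_zero :
  measurable [set t | lp_decides_zero H (fun i => Gamma i t)].
Proof.
rewrite (_ : mkset _ = [set t | forall w, fundamental_polytope H w ->
    w != 0 -> 0 < lp_cost (fun i => Gamma i t) w]).
  apply: (measurable_lp_cost_gt0 (X := fun i => Gamma i)) => //.
  exact: closed_fundamental_polytope.
by apply/seteqP; split=> t /lp_decides_zeroP.
Qed.

Let outcome (S : {set 'I_n}) : set T :=
  \bigcap_(i : 'I_n) (Gamma i @^-1` [set if i \in S then - G else G]).

Let measurable_preimage1 (i : 'I_n) (x : R) : measurable (Gamma i @^-1` [set x]).
Proof. exact: measurable_funPTI. Qed.

Let measurable_outcome S : measurable (outcome S).
Proof. by apply: fin_bigcap_measurable. Qed.

Let prob_outcome S :
  P (outcome S) = (\prod_(i < n) (if i \in S then eps else 1 - eps))%:E.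
Proof.
have [indep law] := llr; rewrite indep => [|i]; last exact: measurable_set1.
rewrite -prodEFin; apply: eq_bigr => i _.
by have [PG PNG] := law i; case: ifP.
Qed.

(** The law prescribes only the masses of two points, which leaves a null set of further values to
    be split off. *)
Let other (i : 'I_n) : set T :=
  ~` (Gamma i @^-1` [set G] `|` Gamma i @^-1` [set - G]).

Let measurable_other i : measurable (other i).
Proof. by apply: measurableC; apply: measurableU. Qed.

Let prob_other i : P (other i) = 0.
Proof.
rewrite probability_setC; last exact: measurableU.
(* The two events are disjoint because [G] is positive, so their masses add up to 1. *)
rewrite measureU//; last first.
  apply/seteqP; split=> t //= -[-> ] e.
  by have := G_gt0; lra.
have [PG PNG] := llr.2 i.
transitivity (1 - ((1 - eps)%:E + eps%:E))%E; last first.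
  by rewrite -EFinD subrK subrr.
by congr (1 - (_ + _))%E.
Qed.

(** Outside a null set the costs come from an error set, which success forces to be small;
    subadditivity over the small error sets then gives the bound. *)
Lemma lp_decides_zero_probability_le (w : nat) : (0 < n)%N -> (2 <= w)%N ->
  (forall j, #|[set i | H j i == 1]%SET| = w) ->
  (P [set t | lp_decides_zero H (fun i => Gamma i t)] <=
   (\sum_(S : {set 'I_n} | (w * #|S| < n)%N)
      \prod_(i < n) (if i \in S then eps else 1 - eps))%:E)%E.
Proof.
move=> n0 w2 Hw.
pose N := \big[setU/set0]_i other i.
pose O := \big[setU/set0]_(S : {set 'I_n} | (w * #|S| < n)%N) outcome S.
have mN : measurable N by exact: bigsetU_measurable.
have mO : measurable O by exact: bigsetU_measurable.
have PN : P N = 0.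
  apply/eqP; rewrite eq_le measure_ge0 andbT.
  apply: (le_trans (measure_bigsetU_le P _ _ measurable_other)).
  by rewrite big1// => i _; exact: prob_other.
rewrite -sumEFin (eq_bigr (fun S => P (outcome S))) => [|S _]; last by rewrite prob_outcome.
apply: le_trans (measure_bigsetU_le P _ _ measurable_outcome).
(* Adjoining the null set [N] leaves the probability of [O] unchanged and makes the inclusion hold
   at every point. *)
rewrite -/O -(measureU0 mO mN PN); apply: le_measure.
- by rewrite inE; exact: measurable_lp_decides_zero.
- by rewrite inE; exact: measurableU.
move=> t /= dz.
have [[i it]|tN] := pselect (exists i, other i t).
  by right; rewrite /N (bigD1 i)//=; left.
left; pose S := [set i | Gamma i t == - G]%SET.
have GS i : Gamma i t = if i \in S then - G else G.
  rewrite inE; case: eqP => // it.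
  by apply: contrapT => it'; apply: tN; exists i => -[].
rewrite /O (bigD1 S)/=; first by left => i _; exact: GS.
apply: (lp_decides_zero_few_errors n0 w2 Hw G_gt0).
by under eq_fun do rewrite -GS.
Qed.

End SuccessProbability.

(** * The asymptotic contradiction *)

Theorem corollary7 (R : realType) (wcol wrow : nat)
    (hcol : (1 <= wcol)%N) (hrow : (2 <= wrow)%N)
    (m n : nat -> nat) (H : forall k : nat, 'M['F_2]_(m k, n k))
    (hreg : forall k : nat, regular_pcm wcol wrow (H k))
    (hn : n k @[k --> \oo] --> \oo)
    (eps : R) (heps0 : 0 < eps) (heps1 : eps < 1 / 2)
    (d : nat -> measure_display) (T : forall k : nat, measurableType (d k))
    (P : forall k : nat, probability (T k) R)
    (Gamma : forall k : nat, 'I_(n k) -> {RV (P k) >-> R})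
    (hGamma : forall k : nat, bsc_llr eps (Gamma k))
    (hsuccess :
      P k [set t | lp_decides_zero (H k) (fun i => Gamma k i t)]
        @[k --> \oo] --> 1%E) :
  eps <= 1 / wrow%:R.
Proof.
have w0 : 0 < wrow%:R :> R by rewrite ltr0n (leq_trans _ hrow).
rewrite ler_pdivlMr// leNgt; apply/negP => hw.
have eps1 : eps <= 1 by lra.
have [|s s0 /andP[b0 b1]] := @chernoff_base_lt1 R wrow eps eps1.
  by rewrite mulrC.
set b : R := _ + _ in b0 b1.
have bn : b ^+ n k @[k --> \oo] --> (0 : R).
  apply: (cvg_comp _ _ hn); apply: cvg_expr.
  by rewrite ger0_norm.
(* The success probability tends to 1 and its upper bound to 0; the level 1/2 separates them at a
   single large index. *)
have half1 : (2^-1%:E < 1 :> \bar R)%E by rewrite lte_fin; lra.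
have half0 : (0 : R) < 2^-1 by lra.
have big_success : \forall k \near \oo,
    (2^-1%:E < P k [set t | lp_decides_zero (H k) (fun i => Gamma k i t)])%E.
  apply: (hsuccess [set y | (2^-1%:E < y)%E]).
  by apply: open_nbhs_nbhs; split; [exact: open_ereal_gt_ereal|].
have small_bound : \forall k \near \oo, b ^+ n k < 2^-1.
  exact: (cvgr_lt _ bn).
have pos_length : \forall k \near \oo, (0 < n k)%N.
  exact: (hn _ (nbhs_infty_gt 0)).
have [k [[]]] := filter_ex (filterI (filterI big_success small_bound) pos_length).
move=> + bk nk; apply/negP; rewrite -leNgt.
apply: le_trans (lp_decides_zero_probability_le heps0 heps1 (hGamma k) nk hrow
  (hreg k).2) _.
rewrite lee_fin; apply: le_trans (ltW bk).
by apply: sum_few_errors_le; rewrite // ltW.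
Qed.
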